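(* If $\mathcal{I}$ is an analytic ideal on $\mathbb{N}$ which is not countably generated, then there is a Polish space $X$ such that $\mathcal{I}$ is not a Baire ideal for $X$.
   Context: An ideal on $\mathbb{N}$ is a family $\mathcal{I}\subset\mathcal{P}(\mathbb{N})$ with $\mathbb{N}\notin\mathcal{I}$, closed under subsets and finite unions; every ideal is assumed to contain the family of all finite subsets of $\mathbb{N}$. $\mathcal{I}$ is countably generated if there is a countable $\beta\subset\mathcal{I}$ such that every $A\in\mathcal{I}$ is contained in some $B\in\beta$. A subset of a Polish space $Y$ is analytic if it is the image of a continuous map from $\mathbb{N}^{\mathbb{N}}$ to $Y$; an ideal is analytic if it is an analytic subset of $2^{\mathbb{N}}$ (identifying $\mathcal{P}(\mathbb{N})$ with $2^{\mathbb{N}}$). For a topological space $X$, $\mathrm{NWD}(X)$ is the family of nowhere dense subsets of $X$. $\mathcal{I}$ is a Baire ideal for $X$ if for every monotonic $f\colon\mathcal{I}\to\mathrm{NWD}(X)$ (i.e. $A\subset B$ implies $f(A)\subset f(B)$) one has $\bigcup\{f(A):A\in\mathcal{I}\}\neq X$. Polish spaces are assumed nonempty. *)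

(* Defs.v *)
From HB Require Import structures.
From mathcomp Require Import all_boot all_order all_algebra.
From mathcomp Require Import boolp classical_sets functions cardinality filter.
From mathcomp Require Import reals topology cantor.

Set Implicit Arguments.
Unset Strict Implicit.
Unset Printing Implicit Defensive.

Import Order.TTheory GRing.Theory Num.Theory.

Local Open Scope classical_set_scope.
Local Open Scope ring_scope.

(* The space N^N, the product of countably many copies of the discrete space
   nat. *)
Definition baire_space : Type := prod_topology (fun _ : nat => nat).

HB.instance Definition _ := Pointed.on baire_space.
HB.instance Definition _ := Nbhs.on baire_space.
HB.instance Definition _ := Topological.on baire_space.

Definition is_metric (R : realType) (T : Type) (d : T -> T -> R) :=
  [/\ forall x y, 0 <= d x y,
      forall x y, d x y = 0 <-> x = y,
      forall x y, d x y = d y x &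
      forall x y z, d x z <= d x y + d y z].

Definition metric_induces (R : realType) (X : topologicalType)
    (d : X -> X -> R) :=
  forall (x : X) (A : set X),
    nbhs x A <-> exists2 e : R, 0 < e & [set y | d x y < e] `<=` A.

Definition metric_complete (R : realType) (X : topologicalType)
    (d : X -> X -> R) :=
  forall u : nat -> X,
    (forall e : R, 0 < e ->
       exists N : nat, forall m n, (N <= m)%N -> (N <= n)%N ->
         d (u m) (u n) < e) ->
    exists l : X, u @ \oo --> l.

Definition completely_metrizable (R : realType) (X : topologicalType) :=
  exists d : X -> X -> R,
    [/\ is_metric d, metric_induces d & metric_complete d].

Definition separable (X : topologicalType) :=
  exists2 D : set X, countable D & dense D.

(* Polish spaces are nonempty by convention. The parameter R only provides the
   values of the metric. *)
Definition polish_space (R : realType) (X : topologicalType) :=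
  [/\ [set: X] !=set0, separable X & completely_metrizable R X].

(* Meant for Y Polish; the empty set is not analytic in this sense. *)
Definition analytic (Y : topologicalType) (A : set Y) :=
  exists2 f : baire_space -> Y, continuous f & A = range f.

Definition nowhere_dense (X : topologicalType) (A : set X) :=
  (closure A)° = set0.

Definition is_ideal (I : set (set nat)) :=
  [/\ ~ I [set: nat],
      forall A B, B `<=` A -> I A -> I B,
      forall A B, I A -> I B -> I (A `|` B) &
      forall A, finite_set A -> I A].

Definition countably_generated (I : set (set nat)) :=
  exists beta : set (set nat),
    [/\ countable beta, beta `<=` I &
        forall A, I A -> exists2 B, beta B & A `<=` B].

(* A point x of 2^N is identified with the set of all n such that x n is
   true. *)
Definition analytic_ideal (I : set (set nat)) :=
  is_ideal I /\ analytic [set x : cantor_space | I [set n | x n]].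

(* A map from I to NWD(X) is represented by a total map f : set nat -> set X of
   which only the values on I matter. *)
Definition baire_ideal (I : set (set nat)) (X : topologicalType) :=
  forall f : set nat -> set X,
    (forall A, I A -> nowhere_dense (f A)) ->
    (forall A B, I A -> I B -> A `<=` B -> f A `<=` f B) ->
    \bigcup_(A in I) f A <> [set: X].

(* Main.v *)
(** Let phi be a continuous map of N^N onto I, and let W be the union of the
    basic cylinders U for which phi(U) is covered by countably many sets P(B)
    with B in I. There are only countably many cylinders, so phi(W) is also
    covered in this way; as I is not countably generated, the closed set
    X = N^N \ W is nonempty, hence Polish. The sets
    f(A) = {x in X | phi(x) is contained in A} are closed, increase with A and
    cover X. If f(A) contained U /\ X for a cylinder U meeting X, then P(A) and
    the sets covering phi(W) would cover phi(U), so that U would be contained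
    in W. *)

Require Import Defs.
From mathcomp Require Import all_boot all_order all_algebra.
From mathcomp Require Import boolp classical_sets functions cardinality filter.
From mathcomp Require Import reals topology cantor.

Set Implicit Arguments.
Unset Strict Implicit.
Unset Printing Implicit Defensive.

Import Order.TTheory GRing.Theory Num.Theory.

Local Open Scope classical_set_scope.
Local Open Scope ring_scope.

(** * Cylinders as a neighbourhood basis of N^N *)

Definition cylinder (s : seq nat) : set baire_space :=
  [set x | mkseq x (size s) = s].

Lemma eq_mkseqP (T : Type) (x y : nat -> T) n :
  mkseq x n = mkseq y n <-> forall i, (i < n)%N -> x i = y i.
Proof.
split=> [xy i lt_in|xy].
  by rewrite -(nth_mkseq (x i) x lt_in) xy nth_mkseq.
by apply/eq_in_map => i; rewrite mem_iota => /xy.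
Qed.

Lemma cylinder_mkseqP (x y : baire_space) n :
  cylinder (mkseq x n) y <-> forall i, (i < n)%N -> y i = x i.
Proof. by rewrite /cylinder /= size_mkseq; exact: eq_mkseqP. Qed.

Lemma nbhs_coord (T : nat -> topologicalType) (x : prod_topology T) (i : nat)
    (B : set (T i)) :
  nbhs (x i) B -> nbhs x [set y : prod_topology T | B (y i)].
Proof. by move=> xiB; exact: (@proj_continuous _ T i x). Qed.

(** The product topology is the coarsest one with continuous coordinates, so the filter generated by
    the cylinders around x converges to x as soon as each coordinate does. Conversely, a cylinder is
    a finite intersection of conditions on single coordinates. *)
Lemma nbhs_baire_spaceP (x : baire_space) (A : set baire_space) :
  nbhs x A <-> exists n, cylinder (mkseq x n) `<=` A.
Proof.
split=> [|[n]].
  pose G := filter_from [set: nat] (fun n => cylinder (mkseq x n)).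
  have FG : Filter G.
    apply: filter_from_filter; first by exists 0%N.
    move=> m n _ _; exists (maxn m n) => // y /cylinder_mkseqP yx.
    by split; apply/cylinder_mkseqP => i lt_i; apply: yx;
      rewrite leq_max lt_i ?orbT.
  suff Gx : G --> x by move=> /Gx [n _ nA]; exists n.
  apply/cvg_sup => i B [_ [[C oC <-] /= Cxi] CB].
  exists i.+1 => // y /cylinder_mkseqP yx; apply: CB => /=.
  by rewrite /mathcomp_extra.proj yx.
elim: n A => [|n IHn] A xA.
  by apply: filterS xA _; apply: filterS filterT => y _; apply/cylinder_mkseqP.
apply: filterS xA _; have := IHn _ (@subset_refl _ _).
have /(@nbhs_coord (fun=> nat) x n) : nbhs (x n) [set x n].
  exact: discrete_set1.
apply: filterS2 => y /= yn /cylinder_mkseqP yx; apply/cylinder_mkseqP => i.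
by rewrite ltnS leq_eqVlt => /predU1P[->|/yx].
Qed.

Lemma open_cylinder s : open (cylinder s).
Proof.
rewrite openE => x xs; apply/nbhs_baire_spaceP; exists (size s).
by rewrite -[X in _ `<=` cylinder X]xs.
Qed.

Lemma nbhs_set_typeP (X : topologicalType) (F : set X) (x : F) (A : set F) :
  nbhs x A <-> exists2 B, nbhs (\val x) B & forall y : F, B (\val y) -> A y.
Proof.
split=> [[_ [[C oC <-] /= Cx] CA]|[B xB BA]].
  by exists C => //; exact: open_nbhs_nbhs.
apply: filterS BA _.
exact: (@initial_continuous F X set_val).
Qed.

(** * A complete metric on N^N *)

Section SubBaireSpace.
Context (R : realType).
Implicit Types x y z : baire_space.

(* The value is 0 when x = y. *)
Definition first_diff x y : nat :=
  if pselect (exists n, x n != y n) is left e then ex_minn e else 0%N.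

Lemma first_diffP x y n : x <> y ->
  (forall i, (i < n)%N -> x i = y i) <-> (n <= first_diff x y)%N.
Proof.
move=> xy; rewrite /first_diff; case: pselect => [e|[]]; last first.
  apply/not_existsP => e; apply: xy; apply/funext => i.
  by apply/eqP/negPn/negP/e.
case: ex_minnP => m xym mP; split=> [xyn|nm i lt_in].
  by rewrite leqNgt; apply/negP => /xyn/eqP; exact/negP.
by apply/eqP/negPn/negP => /mP; rewrite leqNgt (leq_trans lt_in).
Qed.

(** The usual ultrametric. Without the successor, points that differ at coordinate 0 would get the
    distance 0^-1 = 0. *)
Definition baire_dist x y : R :=
  if `[< x = y >] then 0 else (first_diff x y).+1%:R^-1.

(** If k is the first difference, 1/(k+1) < 1/(n+1) means n < k, hence agreement up to n
    included. *)
Lemma baire_dist_ltP x y n :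
  baire_dist x y < n.+1%:R^-1 <-> forall i, (i <= n)%N -> x i = y i.
Proof.
rewrite /baire_dist; case: asboolP => [->|xy].
  by split=> // _; rewrite invr_gt0.
rewrite ltf_pV2 ?posrE// ltr_nat ltnS.
exact: iff_sym (@first_diffP x y n.+1 xy).
Qed.

Lemma baire_dist_ge0 x y : 0 <= baire_dist x y.
Proof. by rewrite /baire_dist; case: asboolP => // _; rewrite invr_ge0. Qed.

(** Reduces bounds on the distance to agreement of coordinates. If r < 1/(k+1) with k the first
    difference, the hypothesis for n = k would make the distance smaller than itself. *)
Lemma baire_dist_le x y (r : R) : 0 <= r ->
    (forall n, r < n.+1%:R^-1 -> forall i, (i <= n)%N -> x i = y i) ->
  baire_dist x y <= r.
Proof.
move=> r0 xyr; rewrite leNgt; apply/negP => rxy.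
have [xy|xy] := asboolP (x = y).
  by move: rxy; rewrite /baire_dist; case: asboolP => // _; rewrite ltNge r0.
have dE : baire_dist x y = (first_diff x y).+1%:R^-1.
  by rewrite /baire_dist; case: asboolP.
move: rxy; rewrite dE => /xyr/baire_dist_ltP.
by rewrite dE ltxx.
Qed.

Lemma baire_dist_metric : is_metric baire_dist.
Proof.
have le_sym x y : baire_dist x y <= baire_dist y x.
  apply: baire_dist_le (baire_dist_ge0 _ _) _ => n /baire_dist_ltP yx i i_n.
  by rewrite yx.
split=> [x y|x y|x y|x y z].
- exact: baire_dist_ge0.
- rewrite /baire_dist; case: asboolP => // xy; split => // /eqP.
  by rewrite invr_eq0 pnatr_eq0.
- by apply/eqP; rewrite eq_le !le_sym.
(* If the sum is below 1/(n+1), so is each term; hence x, y and z agree up to n. *)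
- apply: baire_dist_le => [|n xyz i i_n].
    by rewrite addr_ge0 ?baire_dist_ge0.
  have /baire_dist_ltP-> // : baire_dist x y < n.+1%:R^-1.
    by apply: le_lt_trans xyz; rewrite lerDl baire_dist_ge0.
  have /baire_dist_ltP-> // : baire_dist y z < n.+1%:R^-1.
  by apply: le_lt_trans xyz; rewrite lerDr baire_dist_ge0.
Qed.

Lemma nbhs_baire_distP x (A : set baire_space) :
  nbhs x A <-> exists2 e : R, 0 < e & [set y | baire_dist x y < e] `<=` A.
Proof.
split=> [/nbhs_baire_spaceP[n nA]|[e e0 eA]].
  exists n.+1%:R^-1; first by rewrite invr_gt0.
  move=> y /= /baire_dist_ltP xy; apply/nA/cylinder_mkseqP => i /ltnW i_n.
  by rewrite xy.
have [n] := ltr_add_invr e0; rewrite add0r => ne.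
apply/nbhs_baire_spaceP; exists n.+1 => y /cylinder_mkseqP yx; apply: eA => /=.
by apply: lt_trans ne; apply/baire_dist_ltP => i i_n; rewrite yx.
Qed.

Lemma baire_dist_complete : @metric_complete R baire_space baire_dist.
Proof.
move=> u cu.
have /choice[N NP] (k : nat) : exists N, forall m, (N <= m)%N ->
    forall i, (i <= k)%N -> u N i = u m i.
  have [|N NP] := cu k.+1%:R^-1; first by rewrite invr_gt0.
  by exists N => m Nm; apply/baire_dist_ltP/NP.
(* The limit is read off diagonally: from [N k] on, all terms share their coordinates up to k. *)
exists (fun k => u (N k) k) => A /nbhs_baire_spaceP[n nA].
exists (\max_(k < n) N k)%N => // m /= Nm.
apply/nA/cylinder_mkseqP => i i_n; rewrite (NP i m)//.
exact: leq_trans (leq_bigmax (Ordinal i_n)) Nm.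
Qed.

End SubBaireSpace.

(** * Nonempty closed subspaces of N^N are Polish *)

Lemma closed_completely_metrizable (R : realType) (X : topologicalType)
    (F : set X) :
  closed F -> completely_metrizable R X -> completely_metrizable R F.
Proof.
move=> cF [d [[d0 d1 dC dD] dX dcompl]].
exists (fun x y : F => d (\val x) (\val y)); split.
- split=> // x y; rewrite d1; split=> [/val_inj//|->//].
- move=> x A; split=> [/nbhs_set_typeP[B /dX[e e0 eB] BA]|[e e0 eA]].
    by exists e => // y /eB/BA.
  apply/nbhs_set_typeP; exists [set y | d (\val x) y < e] => //.
  by apply/dX; exists e.
- move=> u /(dcompl (\val \o u))[l ul].
  have Fl : F l.
    apply: cF => B /ul[n _ nB]; exists (\val (u n)).
    by split; [exact: set_valP|exact: (nB n (leqnn n))].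
  exists (exist _ l (mem_set Fl)) => A /nbhs_set_typeP[B lB BA].
  by have [n _ nB] := ul _ lB; exists n => // m /nB; exact: BA.
Qed.

Lemma separable_sub_baire_space (F : set baire_space) : separable F.
Proof.
have [[x0 Fx0]|F0] := pselect (F !=set0); last first.
  exists set0; first exact: countable0.
  by move=> O [x]; case: F0; exists (\val x); exact: set_valP.
(* One point of F in each of the countably many cylinders; the default x0 serves for those that miss
   F. *)
pose p s : F := xget (exist _ x0 (mem_set Fx0)) [set x | cylinder s (\val x)].
exists (range p); first exact: sub_countable (card_image_le _ _) (countableP _).
move=> O [x Ox] oO.
have /nbhs_set_typeP[B /nbhs_baire_spaceP[n nB] BO] : nbhs x O.
  exact: open_nbhs_nbhs.
exists (p (mkseq (\val x) n)); split; last by exists (mkseq (\val x) n).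
apply/BO/nB/(@xgetPex F _ [set y | cylinder _ (\val y)]).
by exists x; apply/cylinder_mkseqP.
Qed.

Lemma polish_closed_baire_space (R : realType) (F : set baire_space) :
  closed F -> F !=set0 -> polish_space R F.
Proof.
move=> cF [x Fx]; split.
- by exists (exist _ x (mem_set Fx)).
- exact: separable_sub_baire_space.
- apply: closed_completely_metrizable cF _.
  exists (@baire_dist R); split.
  + exact: baire_dist_metric.
  + exact: nbhs_baire_distP.
  + exact: baire_dist_complete.
Qed.

Definition support (x : cantor_space) : set nat := [set n | x n].

(** Countable generation relative to a family B: the case B = I is [countably_generated I]. *)
Definition countably_covered (I B : set (set nat)) :=
  exists beta : set (set nat),
    [/\ countable beta, beta `<=` I &
        forall A, B A -> exists2 C, beta C & A `<=` C].

Lemma countably_covered_bigcup (I : set (set nat)) (T : Type) (D : set T)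
    (B : T -> set (set nat)) :
  countable D -> (forall t, D t -> countably_covered I (B t)) ->
  countably_covered I (\bigcup_(t in D) B t).
Proof.
move=> cD DB.
have /choice[beta betaP] (t : T) : exists b : set (set nat), D t ->
    [/\ countable b, b `<=` I & forall A, B t A -> exists2 C, b C & A `<=` C].
  have [/DB[b bP]|nDt] := pselect (D t); first by exists b.
  by exists set0.
exists (\bigcup_(t in D) beta t); split.
- by apply: bigcup_countable => // t /betaP[].
- by move=> A [t /betaP[_ + _]]; exact.
- move=> A [t Dt BA]; have [_ _ /(_ A BA)[C bC AC]] := betaP t Dt.
  by exists C => //; exists t.
Qed.

(** Membership of n in the support depends on coordinate n only, so a point y of the set with y n =
    x n, found close to x, forces n into A. *)
Lemma closed_support_subset (A : set nat) :
  closed [set x : cantor_space | support x `<=` A].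
Proof.
move=> x clx n xn.
have /clx[y [yA /= yn]] :=
  @nbhs_coord (fun=> bool) x n [set x n] (discrete_set1 (x n)).
by apply: yA; rewrite /support /= yn.
Qed.

Theorem proposition4p1 (R : realType) (I : set (set nat)) :
  analytic_ideal I -> ~ countably_generated I ->
  exists X : topologicalType, polish_space R X /\ ~ baire_ideal I X.
Proof.
move=> [_ [phi cphi phiE]] ncI.
pose images (U : set baire_space) := [set support (phi x) | x in U].
pose small := [set s | countably_covered I (images (cylinder s))].
pose W := \bigcup_(s in small) cylinder s.
have coverW : countably_covered I (images W).
  rewrite /images /W image_bigcup; exact: countably_covered_bigcup.
have Iphi x : I (support (phi x)).
  suff : [set x : cantor_space | I [set n | x n]] (phi x) by [].
  by rewrite phiE; exists x.
have F0 : ~` W !=set0.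
  (* If W were the whole space, [coverW] would make I countably generated, since each A in I is the
     support of some phi x. *)
  apply: contrapT => /nonemptyPn/(congr1 setC); rewrite setCK setC0 => WT.
  apply: ncI; have [beta [cb bI bW]] := coverW; exists beta; split => // A IA.
  suff [x xA] : exists x, support (phi x) = A.
    by apply: bW; exists x => //; rewrite WT.
  have : range phi (fun n => `[< A n >]).
    rewrite -phiE /=; congr I: IA; apply/seteqP; split => n /=; by move/asboolP.
  move=> [x _ xA]; exists x; rewrite xA; apply/seteqP; split=> n /= /asboolP//.
have cF : closed (~` W).
  by apply/open_closedC/bigcup_open => s _; exact: open_cylinder.
exists (~` W : set baire_space); split; first exact: polish_closed_baire_space.
pose f A : set (~` W : set baire_space) :=
  [set x | support (phi (\val x)) `<=` A].
move=> /(_ f)[||]; last first.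
- apply/seteqP; split=> // x _; exists (support (phi (\val x))) => //.
- by move=> A B _ _ AB x /= xA n /xA/AB.
move=> A IA.
(* [f A] is the preimage of a closed set under the restriction of phi, so only its interior has to
   be shown empty. *)
rewrite /nowhere_dense; have <- : f A = closure (f A).
  apply/closure_id/(preimage_closed _ (@closed_support_subset A)) => x _.
  apply: continuous_comp; last exact: cphi.
  exact: initial_continuous.
(* An interior point x has a cylinder whose trace on the complement of W lies in [f A]. This
   cylinder turns out to be in [small], which puts x in W. *)
rewrite -subset0 => x /nbhs_set_typeP[B /nbhs_baire_spaceP[n nB] BA].
apply: (set_valP x); exists (mkseq (\val x) n); last exact/cylinder_mkseqP.
have [beta [cb bI bW]] := coverW.
(* A covers the images of the points outside W, [beta] those of the points in W. *)
exists (A |` beta); split.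
- by rewrite -bigcup2E; apply: bigcup_countable => // -[|[|i]] _ /=;
    [exact: countable1| |exact: countable0].
- by move=> C [->|/bI].
- move=> _ [y /nB By <-]; have [Wy|Fy] := pselect (W y).
    by have [|C bC yC] := bW (support (phi y)); [exists y|exists C => //; right].
  exists A; first by left.
  exact: (BA (exist _ y (mem_set Fy)) By).
Qed.
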